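(* Let $r,t\ge 2$ be integers and let $n\ge rt$. Suppose that $G$ is an $n$-vertex complete multipartite graph satisfying $I(K_r(t),G)=I(K_r(t),n)$. Then $G\cong T_k(n)$ for some integer $k\ge r$. In particular, for every integer $n\ge rt$ there exists an integer $k$ such that $I(K_r(t),T_k(n))=I(K_r(t),n)$.
   Context: $K_r(t)$ denotes the complete $r$-partite graph with every part of size $t$. For graphs $F,G$, $I(F,G)$ is the number of subsets $S\subseteq V(G)$ with $|S|=v(F)$ such that $G[S]\cong F$, and $I(F,n)=\max\{I(F,G):v(G)=n\}$. The Turán graph $T_k(n)$ is the complete $k$-partite graph on $n$ vertices whose part sizes differ by at most one. *)

(* Defs.v *)
From mathcomp Require Import all_boot.
Set Implicit Arguments. Unset Strict Implicit. Unset Printing Implicit Defensive.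

Definition simple_graphb (T : finType) (e : rel T) : bool :=
  [forall x, ~~ e x x] && [forall x, forall y, e x y == e y x].

Definition induced_copy (TF T : finType) (eF : rel TF) (eG : rel T)
    (S : {set T}) : bool :=
  (#|S| == #|TF|) &&
  [exists f : {ffun TF -> T},
     [&& injectiveb f, f @: setT == S &
         [forall x, forall y, eF x y == eG (f x) (f y)]]].

Definition Icount (TF T : finType) (eF : rel TF) (eG : rel T) : nat :=
  #|[set S : {set T} | induced_copy eF eG S]|.

Definition Inum (TF : finType) (eF : rel TF) (n : nat) : nat :=
  \max_(g : {ffun 'I_n * 'I_n -> bool} |
          simple_graphb (fun x y => g (x, y)))
     Icount eF (fun x y => g (x, y)).

Definition Krt (r t : nat) : rel ('I_r * 'I_t) :=
  fun x y => x.1 != y.1.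

Definition complete_multipartite (T : finType) (e : rel T) : Prop :=
  exists p : T -> nat, forall x y, e x y = (p x != p y).

(* Turan graph T_k(n) on 'I_n: vertex i lies in part i mod k; the k parts
   have sizes differing by at most one. *)
Definition turan (k n : nat) : rel 'I_n :=
  fun i j => (i %% k) != (j %% k).

Definition graph_iso (T1 T2 : finType) (e1 : rel T1) (e2 : rel T2) : Prop :=
  exists f : T1 -> T2, bijective f /\ forall x y, e1 x y = e2 (f x) (f y).
Arguments Krt r t : clear implicits.
Arguments turan k n : clear implicits.

(* Main.v *)
Require Import Defs.
From mathcomp Require Import all_boot all_order all_algebra.
From mathcomp Require Import ring lra zify.
Set Implicit Arguments. Unset Strict Implicit. Unset Printing Implicit Defensive.

(** For nonadjacent u and v, replacing u by a twin of v or v by a twin of u does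
    not decrease the number of copies of K_r(t), because nonadjacent vertices of
    a copy are twins in it; at a maximizer neither replacement changes the count.
    A maximizer with the most pairs of twins is therefore complete multipartite,
    since one of the two replacements would create more such pairs.

    In a complete multipartite graph, let a be the largest part size and b <= a-2
    another one, and write P = C(a,t)C(b,t), Q = C(a,t)+C(b,t).  The copies meeting
    the two parts number A P + B Q with A and B independent of a and b.  The gain
    of P over the loss of Q in the move (a,b) -> (a-1,b+1) is
    (1/t) (a-1-b) / (1/C(b,t-1) - 1/C(a-1,t-1)).  As the second differences of
    x |-> 1/C(x,t-1) strictly decrease, this ratio is strictly smaller for
    (a+1,b-1), so one of the moves (a-1,b+1), (a+1,b-1) increases the count when
    b >= t.  When b < t, the move (a+1,b-1) does. *)

(** * Convexity of reciprocal binomials and the exchange inequality for two parts *)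

Section BinomialInequality.
Import Order.TTheory GRing.Theory Num.Theory.
Local Open Scope ring_scope.

Section SecondDifferences.
Variables (R : realFieldType) (d : nat -> R).
Hypothesis d2_noninc : forall x, d x.+1 - d x.+2 < d x - d x.+1.

(** The right side telescopes into [D] drops of [d], each at least the drop just after [m + D]. *)
Lemma diff_ge_mul_last m D :
  D%:R * (d (m + D)%N - d (m + D).+1) <= d m - d (m + D)%N.
Proof.
elim: D => [|D IH]; first by rewrite addn0; lra.
have h := d2_noninc (m + D).
rewrite addnS -natr1.
have h0 : (0 : R) <= D%:R by [].
nra.
Qed.

(** Strict convexity of [d]: its mean over the [D.+1] interior points lies below the mean of the two
    outer values. *)
Lemma sum_lt_outer m D :
  2 * \sum_(i < D.+1) d (m.+1 + i)%N < D.+1%:R * (d m + d (m.+1 + D.+1)%N).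
Proof.
elim: D => [|D IH].
  have h := d2_noninc m.
  by rewrite big_ord_recr big_ord0 /= addn0 addn1; lra.
rewrite big_ord_recr /=.
have h := diff_ge_mul_last m D.+2.
rewrite !addnS !addSn -!natr1 in h IH *.
rewrite ?addnS ?addSn in h IH *.
have h2 := d2_noninc (m + D).+2.
have h0 : (0 : R) <= D%:R by [].
nra.
Qed.
End SecondDifferences.

(** Up to a constant, differencing reciprocal binomials raises the lower index by one, so it can be
    iterated. *)
Lemma inv_bin_diff (R : realFieldType) (k m : nat) :
  'C(k + m, k)%:R^-1 - 'C((k + m).+1, k)%:R^-1
  = k%:R / k.+1%:R * 'C((k.+1 + m), k.+1)%:R^-1 :> R.
Proof.
have E1 := mul_bin_down (k + m).+1 k.
have E2 := mul_bin_diag (k + m).+1 k.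
rewrite /= in E1 E2.
have -> : (k.+1 + m = (k + m).+1)%N by [].
have c0 : ('C(k + m, k)%:R : R) != 0 by rewrite pnatr_eq0 -lt0n bin_gt0; lia.
have c1 : ('C((k + m).+1, k)%:R : R) != 0 by rewrite pnatr_eq0 -lt0n bin_gt0; lia.
have c2 : ('C((k + m).+1, k.+1)%:R : R) != 0 by rewrite pnatr_eq0 -lt0n bin_gt0; lia.
have k0 : (k.+1%:R : R) != 0 by rewrite pnatr_eq0.
have km0 : ((k + m).+1%:R : R) != 0 by rewrite pnatr_eq0.
have m0 : (m.+1%:R : R) != 0 by rewrite pnatr_eq0.
have F1 : (k + m).+1%:R * 'C(k + m, k)%:R = m.+1%:R * 'C((k + m).+1, k)%:R :> R.
  by rewrite -!natrM E1; congr (_ * _)%:R; lia.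
have F2 : (k + m).+1%:R * 'C(k + m, k)%:R = k.+1%:R * 'C((k + m).+1, k.+1)%:R :> R.
  by rewrite -!natrM E2.
have -> : 'C((k + m).+1, k)%:R = (k + m).+1%:R * 'C(k + m, k)%:R / m.+1%:R :> R.
  by rewrite F1 mulrC mulKf.
have -> : 'C((k + m).+1, k.+1)%:R = (k + m).+1%:R * 'C(k + m, k)%:R / k.+1%:R :> R.
  by rewrite F2 mulrC mulKf.
have E : (k + m).+1%:R = k%:R + m.+1%:R :> R by rewrite -natrD addnS.
rewrite E in km0 *; move: m.+1%:R k.+1%:R km0 k0 m0 => M K km0 k0 m0.
by field; rewrite c0 km0 k0 m0.
Qed.

(** Two uses of [inv_bin_diff] make the second difference a positive multiple of the reciprocal of
    ['C(k.+2 + x, k.+2)], which decreases strictly in [x]. *)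
Lemma inv_bin_diff2_lt (R : realFieldType) (k : nat) (x : nat) : (0 < k)%N ->
  let d := fun m => 'C(k + m, k)%:R^-1 - 'C((k + m).+1, k)%:R^-1 : R in
  is_true (d x.+1 - d x.+2 < d x - d x.+1).
Proof.
move=> k0 d.
pose K : R := k%:R / k.+1%:R.
pose K' : R := k.+1%:R / k.+2%:R.
have dE y : d y - d y.+1 = K * K' * 'C(k.+2 + y, k.+2)%:R^-1.
  rewrite /d !inv_bin_diff -mulrBr -mulrA; congr (_ * _).
  by rewrite addnS inv_bin_diff.
rewrite !dE ltr_pM2l; last by rewrite !mulr_gt0 ?invr_gt0 ?ltr0n.
rewrite ltf_pV2 ?posrE ?ltr0n ?bin_gt0 ?leq_addr // ltr_nat.
by rewrite addnS binS -[ltnLHS]addn0 ltn_add2l bin_gt0; lia.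
Qed.

(** The mean drop of [g] grows when a window gains one step at each end: [sum_lt_outer] bounds the
    inner drops by the two new ones, and [D.+1] times the inner total is added to both sides. *)
Lemma inv_bin_window (R : realFieldType) (k m D : nat) : (0 < k)%N ->
  let g := fun x => 'C(k + x, k)%:R^-1 : R in
  is_true (D.+3%:R * (g m.+1 - g (m.+1 + D.+1)%N)
             < D.+1%:R * (g m - g (m.+1 + D.+2)%N)).
Proof.
move=> k0 g.
pose d x := g x - g x.+1.
have H x : d x.+1 - d x.+2 < d x - d x.+1.
  by have := inv_bin_diff2_lt R x k0; rewrite /d /g /= !addnS.
have := sum_lt_outer H m D.
have -> : \sum_(i < D.+1) d (m.+1 + i)%N = g m.+1 - g (m.+1 + D.+1)%N.
  elim: D.+1 => [|E IH]; first by rewrite big_ord0 addn0 subrr.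
  by rewrite big_ord_recr /= IH /d -addnS; ring.
rewrite /d -!addnS -!natr1; set s := g m.+1; set s2 := g _; set s3 := g m.
set s4 := g _; lra.
Qed.

(** This is [inv_bin_window] cleared of denominators, with inner window from [b.+1] to [a] and outer
    window from [b] to [a.+1]. *)
Lemma bin_window (R : realFieldType) (k a b : nat) :
  (0 < k)%N -> (k <= b)%N -> (b.+1 < a)%N ->
  let c := fun x => 'C(x, k)%:R : R in
  is_true (c a.+1 * c b * (a.+1%:R - b%:R) * (c a - c b.+1)
             < c a * c b.+1 * (a%:R - b.+1%:R) * (c a.+1 - c b)).
Proof.
move=> k0 kb ba c.
have c_gt0 x : (b <= x)%N -> 0 < c x by move=> h; rewrite ltr0n bin_gt0; lia.
have := inv_bin_window R (b - k) (a - b.+2) k0.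
move=> /=.
have -> : (k + (b - k).+1 = b.+1)%N by lia.
have -> : (k + ((b - k).+1 + (a - b.+2).+1) = a)%N by lia.
have -> : (k + (b - k) = b)%N by lia.
have -> : (k + ((b - k).+1 + (a - b.+2).+2) = a.+1)%N by lia.
have -> : ((a - b.+2).+3 = a.+1 - b)%N by lia.
have -> : ((a - b.+2).+1 = a - b.+1)%N by lia.
rewrite /= !natrB; try lia.
rewrite -!/(c _).
have p0 := c_gt0 a.+1 ltac:(lia). have p1 := c_gt0 a ltac:(lia).
have p2 := c_gt0 b ltac:(lia). have p3 := c_gt0 b.+1 ltac:(lia).
have P : 0 < c a.+1 * c b * (c a * c b.+1) by rewrite !mulr_gt0.
rewrite -(ltr_pM2l P).
have n0 := lt0r_neq0 p0. have n1 := lt0r_neq0 p1.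
have n2 := lt0r_neq0 p2. have n3 := lt0r_neq0 p3.
rewrite [ltLHS](_ : _ = c a.+1 * c b * (a.+1%:R - b%:R) * (c a - c b.+1)); last first.
  by field; rewrite n1 n3.
rewrite [ltRHS](_ : _ = c a * c b.+1 * (a%:R - b.+1%:R) * (c a.+1 - c b)) //.
by field; rewrite n0 n2.
Qed.

(* For part sizes [x], [y], and [A], [B] the numbers of ways to choose [r-2],
   respectively [r-1], fully used parts among the others, this is the number of
   copies of K_r(t) that meet one of the two parts. *)
Definition two_part_count (t A B x y : nat) : nat :=
  ('C(x, t) * 'C(y, t) * A + ('C(x, t) + 'C(y, t)) * B)%N.

(** Sizes are shifted by one so that neither move needs a predecessor. If neither move gained,
    eliminating [B] between the two inequalities would contradict [bin_window]. *)
Lemma two_part_count_not_max (t a b A B : nat) :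
  (1 < t)%N -> (b.+2 < a.+1)%N -> (t <= a.+1)%N -> (0 < A)%N ->
  ((b.+1 < t)%N -> (0 < B)%N) ->
  (two_part_count t A B a b.+2 <= two_part_count t A B a.+1 b.+1)%N ->
  (two_part_count t A B a.+2 b <= two_part_count t A B a.+1 b.+1)%N -> False.
Proof.
case: t => // k; rewrite ltnS => k0 ba ka A0 B0.
(* Here [k] is [t - 1]. If [b < k], the smaller part has fewer than [t] vertices, and enlarging the
   other one gains [B * 'C(a.+1, k)]. *)
have [bk|kb] := ltnP b k.
  rewrite /two_part_count (bin_small (n := b)); last lia.
  rewrite (bin_small (n := b.+1)); last lia.
  move=> _; have := B0 ltac:(lia).
  rewrite binS; have : (0 < 'C(a.+1, k))%N by rewrite bin_gt0; lia.
  nia.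
rewrite /two_part_count => H1 H2.
pose R := rat.
pose c x : R := 'C(x, k)%:R. pose e x : R := 'C(x, k.+1)%:R.
have ec x : (k <= x)%N -> k.+1%:R * e x = (x%:R - k%:R) * c x.
  by move=> h; rewrite /e -natrM mul_bin_left natrM natrB.
(* Pascal's rule cancels the common terms: [h1] says that balancing does not gain, [h2] says so of
   the opposite move. *)
have h1 : A%:R * (e a * c b.+1 - c a * e b.+1) <= B%:R * (c a - c b.+1).
  move: H1; rewrite (binS a) (binS b.+1) /e /c.
  move: 'C(a, k) 'C(a, k.+1) 'C(b.+1, k) 'C(b.+1, k.+1) => ca ea cb eb.
  by rewrite -(ler_nat R) !(natrD, natrM); lra.
have h2 : B%:R * (c a.+1 - c b) <= A%:R * (e a.+1 * c b - c a.+1 * e b).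
  move: H2; rewrite (binS a.+1) (binS b) /e /c.
  move: 'C(a.+1, k) 'C(a.+1, k.+1) 'C(b, k) 'C(b, k.+1) => ca ea cb eb.
  by rewrite -(ler_nat R) !(natrD, natrM); lra.
have w := @bin_window R k a b k0 kb ltac:(lia).
rewrite /= -!/(c _) in w.
have t1 : k.+1%:R * (e a * c b.+1 - c a * e b.+1)
    = c a * c b.+1 * (a%:R - b.+1%:R).
  rewrite mulrBr mulrA [_ * (c a * _)]mulrCA !ec; try lia.
  by ring.
have t2 : k.+1%:R * (e a.+1 * c b - c a.+1 * e b)
    = c a.+1 * c b * (a.+1%:R - b%:R).
  rewrite mulrBr mulrA [_ * (c a.+1 * _)]mulrCA !ec; try lia.
  by ring.
rewrite -t1 -t2 in w.
have q1 : 0 <= c a - c b.+1 by rewrite subr_ge0 ler_nat leq_bin2l; lia.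
have q2 : 0 <= c a.+1 - c b by rewrite subr_ge0 ler_nat leq_bin2l; lia.
have A1 : (0 : R) < A%:R by rewrite ltr0n.
have k1 : (0 : R) < k.+1%:R by rewrite ltr0n.
(* Scaled by these nonnegative differences, [h1] and [h2] share the same multiple of [B] and chain
   into the reverse of [w]. *)
have := ler_wpM2r q2 h1; have := ler_wpM2r q1 h2.
move: w; rewrite -!(mulrA k.+1%:R) ltr_pM2l // -(ltr_pM2l A1).
lra.
Qed.

End BinomialInequality.

(** * Induced copies and the invariance of their number *)

Lemma induced_copyP (TF T : finType) (eF : rel TF) (e : rel T) (S : {set T}) :
  reflect (exists f : TF -> T, [/\ injective f, f @: setT = S &
             forall x y, eF x y = e (f x) (f y)])
          (induced_copy eF e S).
Proof.
apply: (iffP andP) => [[_ /existsP[f /and3P[/injectiveP fi /eqP fS /forallP H]]]|].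
  by exists f; split=> // x y; apply/eqP; move/forallP: (H x).
move=> [f [fi fS H]]; split; first by rewrite -fS card_imset // cardsT.
apply/existsP; exists (finfun f); apply/and3P; split.
- by apply/injectiveP => x y; rewrite !ffunE => /fi.
- by apply/eqP; rewrite -fS; apply: eq_imset => x; rewrite ffunE.
- by apply/forallP => x; apply/forallP => y; rewrite !ffunE H.
Qed.

(** Injectivity is asked on [S] only, since replacing one vertex by another is not injective on the
    whole graph. *)
Lemma induced_copy_imset (TF T T' : finType) (eF : rel TF) (e : rel T)
    (e' : rel T') (h : T -> T') (S : {set T}) :
  {in S &, injective h} -> {in S &, forall x y, e x y = e' (h x) (h y)} ->
  induced_copy eF e S -> induced_copy eF e' (h @: S).
Proof.
move=> hi he /induced_copyP[f [fi fS H]]; apply/induced_copyP.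
have fin x : f x \in S by rewrite -fS imset_f.
exists (h \o f); split.
- by move=> x y /hi/fi->.
- by rewrite -fS -imset_comp.
- by move=> x y; rewrite H he.
Qed.

Lemma Icount_le_inj (TF T T' : finType) (eF : rel TF) (e : rel T) (e' : rel T')
    (h : T -> T') :
  injective h -> (forall x y, e x y = e' (h x) (h y)) ->
  Icount eF e <= Icount eF e'.
Proof.
move=> hi he; rewrite /Icount -(card_imset _ (imset_inj hi)).
apply/subset_leq_card/subsetP => _ /imsetP[S + ->]; rewrite !inE.
by apply: induced_copy_imset => [x y _ _ /hi|x y _ _]; rewrite ?he.
Qed.

Lemma Icount_iso (TF T T' : finType) (eF : rel TF) (e : rel T) (e' : rel T') :
  graph_iso e e' -> Icount eF e = Icount eF e'.
Proof.
move=> [f [[g fK gK] fe]]; apply/eqP; rewrite eqn_leq.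
rewrite (Icount_le_inj _ (can_inj fK) fe).
by apply: (Icount_le_inj _ (can_inj gK)) => x y; rewrite fe !gK.
Qed.

Lemma Icount_ext (TF T : finType) (eF : rel TF) (e e' : rel T) :
  e =2 e' -> Icount eF e = Icount eF e'.
Proof. by move=> ee; apply: Icount_iso; exists id; split=> //; exists id. Qed.

Lemma simple_graphP (T : finType) (e : rel T) :
  reflect (irreflexive e /\ symmetric e) (simple_graphb e).
Proof.
apply: (iffP andP) => -[H1 H2]; split.
- by move=> x; apply/negbTE/(forallP H1).
- by move=> x y; apply/eqP/(forallP (forallP H2 x)).
- by apply/forallP => x; rewrite H1.
- by apply/forallP => x; apply/forallP => y; rewrite H2.
Qed.

Lemma Icount_le_Inum (TF : finType) (eF : rel TF) n (e : rel 'I_n) :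
  simple_graphb e -> Icount eF e <= Inum eF n.
Proof.
move=> /simple_graphP[ei es].
pose g := [ffun xy : 'I_n * 'I_n => e xy.1 xy.2].
rewrite (@Icount_ext _ _ _ _ (fun x y => g (x, y))); last by move=> x y; rewrite ffunE.
apply: (@leq_bigmax_cond _ _ (fun g : {ffun 'I_n * 'I_n -> bool} =>
          Icount eF (fun x y => g (x, y)))).
by apply/simple_graphP; split=> [x|x y]; rewrite !ffunE.
Qed.

Lemma multipartite_simple (T : finType) (L : eqType) (p : T -> L) :
  simple_graphb (fun x y => p x != p y).
Proof.
by apply/simple_graphP; split=> [x|x y]; rewrite ?eqxx 1?eq_sym.
Qed.

(** * Zykov symmetrization *)

Section Symmetrization.
Variables (T : finType).
Implicit Types (e : rel T) (u v x y z : T).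

Definition redirect u v x := if x == u then v else x.

Definition clone e u v : rel T := fun x y => e (redirect u v x) (redirect u v y).

Lemma clone_simple e u v : simple_graphb e -> simple_graphb (clone e u v).
Proof.
move=> /simple_graphP[ei es]; apply/simple_graphP.
by split=> [x|x y]; rewrite /clone.
Qed.

Section Counting.
Variables (TF : finType) (eF : rel TF) (L : eqType) (p : TF -> L).
Hypothesis eF_multipartite : forall x y : TF, eF x y = (p x != p y).

Lemma copy_twins e (S : {set T}) u v y :
  induced_copy eF e S -> u \in S -> v \in S -> y \in S -> ~~ e u v ->
  e u y = e v y.
Proof.
move=> /induced_copyP[f [_ <- H]] /imsetP[a _ ->] /imsetP[b _ ->] /imsetP[c _ ->].
by rewrite -!H !eF_multipartite negbK => /eqP->.
Qed.

Definition copies_sep e u v : {set {set T}} :=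
  [set S | [&& induced_copy eF e S, u \in S & v \notin S]].

(** Cloning can destroy only copies that contain [u] but not [v]. Copies with [v] but not [u]
    survive and give new ones with [v] replaced by [u]; copies with both survive because [u] and [v]
    are twins in them. *)
Lemma Icount_clone e u v : simple_graphb e -> u != v -> ~~ e u v ->
  Icount eF e + #|copies_sep e v u| <= Icount eF (clone e u v) + #|copies_sep e u v|.
Proof.
move=> /simple_graphP[ei es] uv euv; rewrite /Icount.
set C := [set S | _]; set C' := [set S | _].
have cu : redirect u v u = v by rewrite /redirect eqxx.
have cE x : x != u -> redirect u v x = x by rewrite /redirect => /negbTE->.
rewrite -(cardsID (copies_sep e u v) C).
have -> : C :&: copies_sep e u v = copies_sep e u v.
  by apply/setP => S; rewrite !inE andbA andbb.
rewrite [leqLHS]addnC addnA [leqRHS]addnC.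
rewrite [leqLHS]addnAC [leqLHS]addnC leq_add2l.
pose swap := fun x => if x == v then u else x.
have swE x : x != v -> swap x = x by rewrite /swap => /negbTE->.
have swv : swap v = u by rewrite /swap eqxx.
have swK (S : {set T}) : u \notin S -> {in S, cancel swap (redirect u v)}.
  move=> uS x xS; have [->|xv] := eqVneq x v; first by rewrite swv cu.
  by rewrite swE // cE //; apply: contraNneq uS => <-.
have inj : {in copies_sep e v u &, injective (fun S : {set T} => swap @: S)}.
  move=> S1 S2; rewrite !inE => /and3P[_ _ u1] /and3P[_ _ u2] E.
  have K (S : {set T}) : u \notin S -> redirect u v @: (swap @: S) = S.
    move=> uS; rewrite -imset_comp -[RHS]imset_id; apply: eq_in_imset => x xS /=.
    exact: swK xS.
  by rewrite -(K _ u1) E K.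
rewrite -(card_in_imset inj).
(* [D1] holds old copies that survive, [D2] the new ones; only the latter contain [u] without
   [v]. *)
set D1 := C :\: _; set D2 := imset _ _.
have dis : [disjoint D2 & D1].
  rewrite disjoints_subset; apply/subsetP => _ /imsetP[S + ->].
  rewrite !inE => /and3P[cS vS uS].
  have -> : u \in swap @: S by rewrite -swv imset_f.
  have -> : v \notin swap @: S.
    apply/imsetP => -[x xS]; rewrite /swap; case: eqP => [_ E|ne E].
      by rewrite E eqxx in uv.
    by rewrite E in ne.
  by rewrite /= andbT negb_and orNb.
have /leqifP := leq_card_setU D2 D1; rewrite dis => /eqP<-.
apply/subset_leq_card/subsetP => S; rewrite inE => /orP[/imsetP[S' + ->]|].
  rewrite !inE => /and3P[cS vS uS]; apply: induced_copy_imset cS.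
    exact: can_in_inj (swK _ uS).
  by move=> x y xS yS; rewrite /clone !(swK _ uS).
rewrite !inE => /andP[+ cS]; rewrite cS /= negb_and negbK => uvS.
rewrite -[S]imset_id; apply: (induced_copy_imset _ _ (cS)) => // x y xS yS.
rewrite /clone.
case/boolP: (u \in S) uvS => uS /= vS; last first.
  by rewrite !cE //; apply: contraNneq uS => <-.
have tw z : z \in S -> e u z = e v z.
  by move=> zS; exact: copy_twins cS uS vS zS euv.
rewrite /redirect; case: eqP => [->|_]; case: eqP => [->|_] //.
- by rewrite !ei.
- exact: tw.
- by rewrite es tw // es.
Qed.

(** Adding [Icount_clone] for both directions cancels the separating copies, so the two clones
    average at least the count of [e]; maximality makes both equal to it. *)
Lemma clone_max e u v : simple_graphb e -> u != v -> ~~ e u v ->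
  (forall e', simple_graphb e' -> Icount eF e' <= Icount eF e) ->
  Icount eF (clone e u v) = Icount eF e.
Proof.
move=> se uv euv mx; have /simple_graphP[ei es] := se.
have := Icount_clone se uv euv.
have := @Icount_clone e v u se; rewrite eq_sym es => /(_ uv euv).
have := mx _ (clone_simple u v se); have := mx _ (clone_simple v u se).
lia.
Qed.

End Counting.

Definition twins e : rel T := fun x y => [forall z, e x z == e y z].

Definition twin_count e : nat := \sum_x \sum_y twins e x y.

(** Leaving its class costs [u] one less than the class size, as [u] is in it; joining the class of
    [v] gains that whole class. So the gain is strict even between classes of equal size. *)
Lemma twin_count_clone e u v : ~~ twins e u v ->
  \sum_y twins e u y <= \sum_y twins e v y ->
  twin_count e < twin_count (clone e u v).
Proof.
move=> tuv.
have tC x y : twins e x y = twins e y x by apply: eq_forallb => z; rewrite eq_sym.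
have tv x : twins e x x by apply/forallP => z.
pose c := redirect u v.
have cE x : x != u -> c x = x by rewrite /c /redirect => /negbTE->.
have cu : c u = v by rewrite /c /redirect eqxx.
have H : \sum_x \sum_y twins e (c x) (c y) <= twin_count (clone e u v).
  apply: leq_sum => x _; apply: leq_sum => y _.
  case: (boolP (twins e _ _)) => // /forallP t; rewrite [X in _ <= nat_of_bool X](_ : _ = true) //.
  by apply/forallP => z; apply: t.
move=> tle; apply: leq_trans H.
have S (f : T -> nat) : \sum_x f x = f u + \sum_(x | x != u) f x by rewrite (bigD1 u).
have S2 (f : T -> T -> nat) : (forall x y, f x y = f y x) ->
    \sum_x \sum_y f x y =
    f u u + (\sum_(y | y != u) f u y).*2 + \sum_(x | x != u) \sum_(y | y != u) f x y.
  move=> fC; rewrite S (S (f u)) (eq_bigr _ (fun x _ => S (f x))) big_split /=.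
  by rewrite (eq_bigr _ (fun x _ => fC x u)) -addnn !addnA.
rewrite /twin_count !S2; try by move=> x y; rewrite tC.
rewrite cu !tv.
have -> : \sum_(y | y != u) twins e v (c y) = \sum_(y | y != u) twins e v y.
  by apply: eq_bigr => y /cE->.
have -> : \sum_(x | x != u) \sum_(y | y != u) twins e (c x) (c y)
        = \sum_(x | x != u) \sum_(y | y != u) twins e x y.
  by apply: eq_bigr => x /cE->; apply: eq_bigr => y /cE->.
move: tle; rewrite !S !tv tC (negbTE tuv).
lia.
Qed.

End Symmetrization.

Lemma multipartite_maximizer (TF : finType) (eF : rel TF) n :
  complete_multipartite eF ->
  exists e : rel 'I_n,
    [/\ simple_graphb e, complete_multipartite e & Icount eF e = Inum eF n].
Proof.
move=> [p eFp].
pose rl (g : {ffun 'I_n * 'I_n -> bool}) : rel 'I_n := fun x y => g (x, y).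
pose g0 : {ffun 'I_n * 'I_n -> bool} := [ffun => false].
have s0 : simple_graphb (rl g0).
  by apply/simple_graphP; split=> [x|x y]; rewrite /rl !ffunE.
have [g1 s1 E1] : exists2 g, simple_graphb (rl g) & Inum eF n = Icount eF (rl g).
  by have [|g] := @eq_bigmax_cond _ (fun g => simple_graphb (rl g)) 
       (fun g => Icount eF (rl g)); [apply/card_gt0P; exists g0 | exists g].
pose P g := simple_graphb (rl g) && (Icount eF (rl g) == Inum eF n).
have P1 : P g1 by rewrite /P s1 E1 eqxx.
have [g /andP[sg /eqP cg] gmax] :=
  @arg_maxnP _ g1 P (fun g => twin_count (rl g)) P1.
have mx (e' : rel 'I_n) : simple_graphb e' -> Icount eF e' <= Icount eF (rl g).
  by rewrite cg; apply: Icount_le_Inum.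
have [ei es] := simple_graphP _ sg.
(* If nonadjacent vertices were not twins, redirecting the one with no more twins to the other would
   give a maximizer with larger [twin_count]. *)
have tw u v : ~~ rl g u v -> twins (rl g) u v.
  move=> euv; apply/negPn/negP => tuv.
  wlog le : u v euv tuv / \sum_y twins (rl g) u y <= \sum_y twins (rl g) v y.
    move=> W; case/orP: (leq_total (\sum_y twins (rl g) u y) (\sum_y twins (rl g) v y)).
      exact: W.
    apply: W; first by rewrite es.
    by apply: contra tuv => /forallP t; apply/forallP => z; rewrite eq_sym.
  have uv : u != v by apply: contraNneq tuv => ->; apply/forallP => z.
  pose h := [ffun xy : 'I_n * 'I_n => clone (rl g) u v xy.1 xy.2].
  have hE : rl h =2 clone (rl g) u v by move=> x y; rewrite /rl ffunE.
  have Ph : P h.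
    rewrite /P (Icount_ext _ hE) (clone_max eFp sg uv euv mx) cg eqxx andbT.
    have [ci cs] := simple_graphP _ (clone_simple u v sg).
    by apply/simple_graphP; split=> [x|x y]; rewrite !hE.
  have : twin_count (rl h) <= twin_count (rl g) := gmax _ Ph.
  rewrite leqNgt => /negP; apply.
  have -> : twin_count (rl h) = twin_count (clone (rl g) u v).
    apply: eq_bigr => x _; apply: eq_bigr => y _; congr nat_of_bool.
    by apply: eq_forallb => z; rewrite !hE.
  exact: twin_count_clone.
exists (rl g); split=> //.
(* The label of a vertex encodes its neighbourhood: [tw] makes nonadjacent vertices agree, while an
   edge puts [y] in the neighbourhood of [x] but not in its own. *)
exists (fun x => enum_rank [set y | rl g x y] : nat) => x y.
apply/idP/idP => [exy|]; last first.
  apply: contraR => /tw/forallP t; apply/eqP; congr (nat_of_ord (enum_rank _)).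
  by apply/setP => z; rewrite !inE; apply/eqP.
by apply/eqP => /ord_inj/enum_rank_inj/setP/(_ y); rewrite !inE exy ei.
Qed.

(** * Copies of K_r(t) in a complete multipartite graph given by labels *)

Section Fibers.
Variables (T : finType) (L : eqType).
Implicit Types (p : T -> L) (S X : {set T}) (l : L) (ls : seq L).

Definition fiber p l : {set T} := [set x | p x == l].

Lemma sum_fibers p S ls :
  uniq ls -> {in S, forall x, p x \in ls} ->
  \sum_(l <- ls) #|S :&: fiber p l| = #|S|.
Proof.
move=> ul pS; rewrite -sum1_card.
transitivity (\sum_(l <- ls) \sum_(x in S | p x == l) 1).
  by apply: eq_bigr => l _; rewrite sum1dep_card; apply: eq_card => x; rewrite !inE.
rewrite (exchange_big_dep (mem S)) /=; last by move=> l x _ /andP[].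
apply: eq_bigr => x xS.
rewrite (eq_bigl (pred1 (p x))); last by move=> l; rewrite /= xS eq_sym.
by rewrite sum1_count count_uniq_mem // pS.
Qed.

(** Coordinates on [S] that build both the embedding of K_r(t) and the isomorphism with a Turan
    graph; [l0] and [x0] are [nth] defaults. *)
Definition fiber_nth p S ls l0 x0 i j : T :=
  nth x0 (enum (S :&: fiber p (nth l0 ls i))) j.

Section FiberNth.
Variables (p : T -> L) (S : {set T}) (ls : seq L) (l0 : L) (x0 : T).
Let F := fiber_nth p S ls l0 x0.

Lemma fiber_nth_mem i j : j < #|S :&: fiber p (nth l0 ls i)| ->
  F i j \in S /\ p (F i j) = nth l0 ls i.
Proof.
rewrite cardE => /(mem_nth x0); rewrite mem_enum => /setIP[? ].
by rewrite inE => /eqP.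
Qed.

Lemma fiber_nth_inj i j i' j' : uniq ls -> i < size ls -> i' < size ls ->
  j < #|S :&: fiber p (nth l0 ls i)| -> j' < #|S :&: fiber p (nth l0 ls i')| ->
  F i j = F i' j' -> i = i' /\ j = j'.
Proof.
move=> ul li li' lj lj' E.
have [_ pE] := fiber_nth_mem lj; have [_ pE'] := fiber_nth_mem lj'.
have Ei : i = i' by apply/eqP; rewrite -(nth_uniq l0 li li' ul) -pE -pE' E.
split=> //; move: E; rewrite /F /fiber_nth -Ei => /eqP.
by rewrite nth_uniq ?enum_uniq -?cardE // ?Ei // => /eqP.
Qed.

End FiberNth.
Arguments fiber_nth_mem {p S ls l0} x0 {i j}.

(** Describes copies without an embedding: every part that [S] meets supplies [t] vertices, and for
    [t > 0] the size of [S] then says that [r] parts are met. *)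
Definition valid p t r S :=
  (#|S| == r * t) && [forall x in S, #|S :&: fiber p (p x)| == t].

Lemma validP p t r S :
  reflect (#|S| = r * t /\ {in S, forall x, #|S :&: fiber p (p x)| = t})
          (valid p t r S).
Proof.
apply: (iffP andP) => -[H1 H2]; split; first exact/eqP.
- by move=> x xS; apply/eqP/(forall_inP H2).
- exact/eqP.
- by apply/forall_inP => x xS; apply/eqP/H2.
Qed.

Lemma induced_copy_Krt p t r S : 0 < t -> 0 < r ->
  induced_copy (Krt r t) (fun x y => p x != p y) S = valid p t r S.
Proof.
move=> t0 r0; apply/induced_copyP/validP => [[f [fi fS H]]|[cS fS]].
  split; first by rewrite -fS card_imset // cardsT card_prod !card_ord.
  move=> x; rewrite -{1}fS => /imsetP[[i j] _ ->{x}].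
  have -> : S :&: fiber p (p (f (i, j))) = (fun j' => f (i, j')) @: 'I_t.
    apply/setP => x; rewrite !inE -fS; apply/andP/imsetP.
      move=> [/imsetP[[i' j'] _ ->]]; rewrite -[_ == _]negbK -H /Krt /= negbK.
      by move/eqP->; exists j'.
    move=> [j' _ ->]; rewrite imset_f //; split=> //.
    by rewrite -[_ == _]negbK -H /Krt /= negbK.
  by rewrite card_imset ?card_ord // => j1 j2 /fi[].
pose ls := undup [seq p x | x <- enum S].
have pls x : x \in S -> p x \in ls.
  by move=> xS; rewrite mem_undup map_f // mem_enum.
have ul : uniq ls by exact: undup_uniq.
have lsS l : l \in ls -> #|S :&: fiber p l| = t.
  by rewrite mem_undup => /mapP[x + ->]; rewrite mem_enum => /fS.
(* Each label met accounts for [t] of the [r * t] vertices. *)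
have sz : size ls = r.
  apply/eqP; rewrite -(eqn_pmul2r t0) -cS -(sum_fibers ul pls).
  rewrite big_seq (eq_bigr (fun=> t)); last by move=> l; apply: lsS.
  by rewrite -big_seq big_const_seq count_predT iter_addn_0 mulnC.
have [x0 x0S] : exists x, x \in S by apply/card_gt0P; rewrite cS muln_gt0 r0.
pose f (a : 'I_r * 'I_t) := fiber_nth p S ls (p x0) x0 a.1 a.2.
have lt_f (a : 'I_r * 'I_t) : a.2 < #|S :&: fiber p (nth (p x0) ls a.1)|.
  by rewrite lsS // mem_nth // sz.
have fi : injective f.
  move=> [i j] [i' j'] /(fiber_nth_inj ul).
  rewrite !sz => /(_ (ltn_ord _) (ltn_ord _) (lt_f (i, j)) (lt_f (i', j'))).
  by move=> /= [/ord_inj-> /ord_inj->].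
exists f; split=> //.
  apply/eqP; rewrite eqEcard card_imset // cardsT card_prod !card_ord cS leqnn.
  by rewrite andbT; apply/subsetP => _ /imsetP[a _ ->]; have [] := fiber_nth_mem x0 (lt_f a).
move=> a b; have [_ ->] := fiber_nth_mem x0 (lt_f a).
have [_ ->] := fiber_nth_mem x0 (lt_f b).
by rewrite nth_uniq ?sz.
Qed.

(** * Counting copies by removing parts one at a time *)

Definition valid_count p t r X := #|[set S : {set T} | (S \subset X) && valid p t r S]|.

Lemma Icount_Krt p t r : 0 < t -> 0 < r ->
  Icount (Krt r t) (fun x y => p x != p y) = valid_count p t r setT.
Proof.
move=> t0 r0; apply: eq_card => S; rewrite !inE subsetT.
exact: induced_copy_Krt.
Qed.

Lemma valid_congr p p' t r S : {in S, p =1 p'} -> valid p t r S = valid p' t r S.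
Proof.
move=> pp; congr (_ && _); apply: eq_forallb_in => x xS; congr (#|pred_of_set _| == _).
by apply/setP => y; rewrite !inE; case: (boolP (y \in S)) => //= yS; rewrite !pp.
Qed.

Lemma valid_count_congr p p' t r X :
  {in X, p =1 p'} -> valid_count p t r X = valid_count p' t r X.
Proof.
move=> pp; apply: eq_card => S; rewrite !inE; apply: andb_id2l => /subsetP SX.
by apply: valid_congr => x /SX /pp.
Qed.

Lemma valid_setD p t r S l :
  #|S :&: fiber p l| = t -> valid p t r.+1 S = valid p t r (S :\: fiber p l).
Proof.
move=> ct; have cS := cardsID (fiber p l) S; rewrite ct in cS.
have E x : x \notin fiber p l ->
    (S :\: fiber p l) :&: fiber p (p x) = S :&: fiber p (p x).
  move=> xl; apply/setP => y; rewrite !inE; have [->|] := eqVneq (p y) (p x).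
    by move: xl; rewrite inE => ->.
  by rewrite !andbF.
apply/validP/validP => -[c H]; split.
- by move: c; rewrite -cS mulSn => /addnI.
- by move=> x /setDP[xS xl]; rewrite E // H.
- by rewrite -cS c.
- move=> x xS; have [xl|xl] := boolP (x \in fiber p l).
    by move: xl ct; rewrite inE => /eqP->.
  by rewrite -E // H // inE xl.
Qed.

(** A valid set either avoids the part or takes [t] of its vertices, chosen independently of the
    remainder, which is valid for one part fewer. *)
Lemma valid_count_fiber p t r X l : 0 < t -> fiber p l \subset X ->
  valid_count p t r.+1 X =
  valid_count p t r.+1 (X :\: fiber p l) +
  'C(#|fiber p l|, t) * valid_count p t r (X :\: fiber p l).
Proof.
move=> t0 FX; set F := fiber p l in FX *.
pose D := [set S : {set T} | S :&: F == set0].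
rewrite /valid_count -(cardsID D); congr (_ + _).
  apply: eq_card => S; rewrite !inE subsetD -setI_eq0.
  by rewrite andbAC.
rewrite -cards_draws -cardsX -(@card_in_imset _ _ (fun AB => AB.1 :|: AB.2)).
  apply: eq_card => S; rewrite !inE; apply/andP/imsetP.
    move=> [SF /andP[SX vS]].
    have ct : #|S :&: F| = t.
      have [x /setIP[xS]] := set0Pn _ SF; rewrite inE => /eqP xl.
      by have [_ /(_ x xS)] := validP _ _ _ _ vS; rewrite xl.
    exists (S :&: F, S :\: F); last by rewrite /= setID.
    by rewrite !inE /= subsetIr ct eqxx setSD //= -valid_setD.
  move=> [[A B]]; rewrite !inE /= subsetD => /andP[/andP[AF /eqP cA] /andP[/andP[BX BF] vB]] ->.
  have EI : (A :|: B) :&: F = A.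
    by rewrite setIUl (setIidPl AF) (disjoint_setI0 BF) setU0.
  have ED : (A :|: B) :\: F = B.
    by rewrite setDUl (setDidPl BF); move: AF; rewrite -setD_eq0 => /eqP->; rewrite set0U.
  rewrite EI subUset (subset_trans AF FX) BX (@valid_setD _ _ _ _ l) ?EI // -/F ED vB.
  by rewrite -card_gt0 cA.
move=> [A B] [A' B']; rewrite !inE /= !subsetD.
move=> /andP[/andP[AF _] /andP[/andP[_ BF] _]] /andP[/andP[AF' _] /andP[/andP[_ BF'] _]] E.
congr (_, _).
  move: (congr1 (fun S => S :&: F) E).
  by rewrite !setIUl (setIidPl AF) (setIidPl AF') !disjoint_setI0 // !setU0.
move: (congr1 (fun S => S :\: F) E).
rewrite !setDUl (setDidPl BF) (setDidPl BF').
by move: AF AF'; rewrite -!setD_eq0 => /eqP-> /eqP->; rewrite !set0U.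
Qed.

Lemma valid_count_gt0_pred p t r X : 0 < t ->
  0 < valid_count p t r.+1 X -> 0 < valid_count p t r X.
Proof.
move=> t0 /card_gt0P[S]; rewrite inE => /andP[SX vS].
have [cS fS] := validP _ _ _ _ vS.
have [x xS] : exists x, x \in S by apply/card_gt0P; rewrite cS muln_gt0.
apply/card_gt0P; exists (S :\: fiber p (p x)).
by rewrite inE -valid_setD ?fS // vS (subset_trans _ SX) ?subsetDl.
Qed.

(** The pattern has [r.+2] parts: [r] or [r.+1] of them remain to be found in [Y] when both or
    exactly one of the two fibers are used. *)
Lemma valid_count_two_fibers p t r l l' : 0 < t -> l != l' ->
  let Y := ~: (fiber p l :|: fiber p l') in
  valid_count p t r.+2 setT =
    two_part_count t (valid_count p t r Y) (valid_count p t r.+1 Y)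
      #|fiber p l| #|fiber p l'| + valid_count p t r.+2 Y.
Proof.
move=> t0 ll Y; rewrite (@valid_count_fiber _ _ _ _ l) // ?subsetT //.
have sub : fiber p l' \subset setT :\: fiber p l.
  apply/subsetP => x; rewrite !inE => /eqP->; by rewrite eq_sym ll.
rewrite !(@valid_count_fiber p t _ (setT :\: fiber p l) l') //.
have -> : setT :\: fiber p l :\: fiber p l' = Y by rewrite setDDl setTD.
rewrite /two_part_count; nia.
Qed.

Definition move_to p v l : T -> L := fun x => if x == v then l else p x.

(** The move changes neither [Y] nor the labels on it, so only the two sizes differ. *)
Lemma two_part_count_move p t r v l : 0 < t -> p v != l ->
  let Y := ~: (fiber p (p v) :|: fiber p l) in
  let p' := move_to p v l in
  valid_count p' t r.+2 setT =
    two_part_count t (valid_count p t r Y) (valid_count p t r.+1 Y)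
      #|fiber p (p v)|.-1 #|fiber p l|.+1 + valid_count p t r.+2 Y.
Proof.
move=> t0 pv Y p'; rewrite (@valid_count_two_fibers _ _ _ _ _ t0 pv).
have E1 : fiber p' (p v) = fiber p (p v) :\ v.
  apply/setP => x; rewrite !inE /p' /move_to; have [_|//] := eqVneq x v.
  by rewrite eq_sym (negbTE pv).
have E2 : fiber p' l = v |: fiber p l.
  by apply/setP => x; rewrite !inE /p' /move_to; have [_|//] := eqVneq x v; rewrite eqxx.
have EY : ~: (fiber p' (p v) :|: fiber p' l) = Y.
  rewrite E1 E2 /Y; congr (~: _); apply/setP => x; rewrite !inE.
  by have [->|] := eqVneq x v; rewrite ?eqxx.
have pp : {in Y, p' =1 p}.
  by move=> x; rewrite /p' /move_to; have [->|//] := eqVneq x v; rewrite !inE eqxx.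
rewrite EY !(valid_count_congr _ _ pp) E1 E2 cardsU1 inE pv.
by rewrite [in RHS](cardsD1 v) inE eqxx.
Qed.

End Fibers.

(** * Balanced part sizes and Turan graphs *)

Lemma valid_count_max_balanced (T : finType) (L : eqType) (p : T -> L) t r :
  1 < t -> 0 < valid_count p t r.+2 setT ->
  (forall p' : T -> L, valid_count p' t r.+2 setT <= valid_count p t r.+2 setT) ->
  forall x y, #|fiber p (p x)| <= #|fiber p (p y)|.+1.
Proof.
move=> t1 pos mx x y; rewrite leqNgt; apply/negP => lt_yx.
have t0 := ltnW t1.
(* A largest part replaces that of [x]; it has at least [t] vertices because some copy exists. *)
have [z _ zmax] := @arg_maxnP _ x xpredT (fun z => #|fiber p (p z)|) isT.
have tz : t <= #|fiber p (p z)|.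
  have /card_gt0P[S] := pos; rewrite inE => /andP[_ /validP[cS fS]].
  have [w wS] : exists w, w \in S by apply/card_gt0P; rewrite cS muln_gt0.
  apply: leq_trans (zmax w isT); rewrite -[leqLHS](fS w wS).
  exact/subset_leq_card/subsetIr.
have {lt_yx} lt_yz := leq_trans lt_yx (zmax x isT).
have zy : p z != p y by apply: contraTneq lt_yz => ->; rewrite -leqNgt.
have y0 : 0 < #|fiber p (p y)| by apply/card_gt0P; exists y; rewrite inE.
have := mx (move_to p z (p y)); rewrite two_part_count_move //.
have := mx (move_to p y (p z)); rewrite two_part_count_move 1?eq_sym //.
rewrite (setUC (fiber p (p y))) (@valid_count_two_fibers _ _ _ _ _ (p z) (p y)) //.
set Y := ~: _; rewrite !leq_add2r.
move: pos; rewrite (@valid_count_two_fibers _ _ _ _ _ (p z) (p y)) // -/Y.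
have AB := @valid_count_gt0_pred _ _ p t r Y t0.
have BE := @valid_count_gt0_pred _ _ p t r.+1 Y t0.
move: (valid_count p t r Y) (valid_count p t r.+1 Y) (valid_count p t r.+2 Y) AB BE.
move=> A B E AB BE.
case: #|fiber p (p z)| tz lt_yz => [|a] ta lt_ba; first lia.
case: #|fiber p (p y)| y0 lt_ba => [//|b] _ lt_ba.
move=> pos h1 h2.
have sym c d : two_part_count t A B c d = two_part_count t A B d c.
  by rewrite /two_part_count (mulnC 'C(c, t)) (addnC 'C(c, t)).
rewrite /= (sym b) in h1.
apply: (two_part_count_not_max t1 _ ta _ _ h2 h1) => //.
  (* Deleting parts from copies shows that [A = 0] forces [B = 0] and [E = 0], leaving no copy at
     all. *)
  rewrite lt0n; apply: contraTneq pos => A0.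
  have B0 : B = 0 by case: B AB {BE h1 h2 sym} => // B; rewrite A0 => /(_ isT).
  have E0 : E = 0 by case: E BE => // E; rewrite B0 => /(_ isT).
  by rewrite /two_part_count A0 B0 E0 !muln0.
move=> bt; rewrite lt0n; apply: contraTneq pos => B0.
have E0 : E = 0 by case: E BE => // E; rewrite B0 => /(_ isT).
by rewrite /two_part_count (bin_small bt) B0 E0 muln0 mul0n muln0.
Qed.

(** List the [b] parts of size [q.+1] before those of size [q]. As [n = q * k + b] with [b < k],
    part [i] is as large as the residue class of [i] modulo [k], and [m] can go to place [m %/ k] of
    part [m %% k]. *)
Lemma balanced_turan n (L : eqType) (p : 'I_n -> L) : 0 < n ->
  (forall x y, #|fiber p (p x)| <= #|fiber p (p y)|.+1) ->
  graph_iso (fun x y => p x != p y)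
    (turan (size (undup [seq p x | x <- enum 'I_n])) n).
Proof.
move=> n0 bal; pose x0 := Ordinal n0.
have [z _ zmin] := @arg_minnP _ x0 xpredT (fun z => #|fiber p (p z)|) isT.
set q := #|fiber p (p z)| in zmin.
pose ls0 := undup [seq p x | x <- enum 'I_n].
pose big l := q < #|fiber p l|.
pose ls := filter big ls0 ++ filter (predC big) ls0.
pose k := size ls. pose b := size (filter big ls0).
have perm : perm_eq ls ls0 by rewrite perm_filterC.
have -> : size (undup [seq p x | x <- enum 'I_n]) = k by rewrite -(perm_size perm).
have ul : uniq ls by rewrite (perm_uniq perm) undup_uniq.
have pls x : p x \in ls by rewrite (perm_mem perm) mem_undup map_f // mem_enum.
have ls_p l : l \in ls -> exists x, l = p x.
  by rewrite (perm_mem perm) mem_undup => /mapP[x _ ->]; exists x.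
have kb : b < k.
  rewrite /k /ls size_cat -/b -[ltnLHS]addn0 ltn_add2l -has_predT.
  apply/hasP; exists (p z) => //; rewrite mem_filter /= /big -/q ltnn /=.
  by rewrite -(perm_mem perm).
have fE i : i < k -> #|fiber p (nth (p x0) ls i)| = q + (i < b).
  move=> ik; have [x E] := ls_p _ (mem_nth (p x0) ik).
  have h1 := bal x z; have h2 : q <= #|fiber p (p x)| := zmin x isT.
  rewrite -E -/q in h1 h2.
  have [ib|ib] := ltnP i b.
    have : nth (p x0) ls i \in filter big ls0 by rewrite nth_cat ib mem_nth.
    by rewrite mem_filter => /andP[]; rewrite /big; lia.
  have : nth (p x0) ls i \in filter (predC big) ls0.
    rewrite nth_cat ltnNge -/b ib /= mem_nth //.
    by move: ik; rewrite /k size_cat -/b; lia.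
  rewrite mem_filter => /andP[]; rewrite /= /big -leqNgt => h3 _.
  by apply/eqP; rewrite addn0 eqn_leq h3 h2.
have nE : n = q * k + b.
  rewrite -[LHS]card_ord -cardsT -(sum_fibers (p := p) ul); last by move=> x _; apply: pls.
  rewrite (big_nth (p x0)) -/k big_mkord.
  under eq_bigr do rewrite setTI fE //.
  rewrite big_split /= sum_nat_const card_ord mulnC; congr (_ + _).
  rewrite (eq_bigr (fun i : 'I_k => if i < b then 1 else 0)) // -big_mkcond /=.
  by rewrite -(big_ord_widen k (fun=> 1) (ltnW kb)) sum1_card card_ord.
pose f (m : 'I_n) := fiber_nth p setT ls (p x0) x0 (m %% k) (m %/ k).
have k0 : 0 < k by apply: leq_ltn_trans kb.
have mk (m : 'I_n) : m %% k < k by rewrite ltn_mod.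
have lt_f (m : 'I_n) : m %/ k < #|[set: 'I_n] :&: fiber p (nth (p x0) ls (m %% k))|.
  rewrite setTI fE //; have := ltn_ord m.
  rewrite {1}(divn_eq m k) [X in _ < X -> _]nE.
  by have := mk m; move: (m %/ k) (m %% k) => j i; case: ltnP; nia.
have fi : injective f.
  move=> m m' /(fiber_nth_inj ul (mk m) (mk m') (lt_f m) (lt_f m')) [E1 E2].
  by apply: val_inj; rewrite /= (divn_eq m k) (divn_eq m' k) E1 E2.
have [g fK gK] := injF_bij fi.
exists g; split; first by exists f.
move=> x y; rewrite /turan -{1}(gK x) -{1}(gK y).
have [_ ->] := fiber_nth_mem x0 (lt_f (g x)).
have [_ ->] := fiber_nth_mem x0 (lt_f (g y)).
by rewrite nth_uniq.
Qed.

(** * Existence of copies and the extremal theorem *)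

Lemma Inum_Krt_gt0 r t n : r * t <= n -> 0 < Inum (Krt r t) n.
Proof.
move=> rtn.
(* The parts are blocks of [t] consecutive vertices; the first [r] blocks form a copy. *)
apply: leq_trans (Icount_le_Inum _ (multipartite_simple (fun x : 'I_n => x %/ t))).
have lt_n (a : 'I_r * 'I_t) : a.1 * t + a.2 < n.
  apply: leq_trans rtn; have : a.1.+1 * t <= r * t by rewrite leq_mul2r ltn_ord orbT.
  by have := ltn_ord a.2; rewrite mulSn; lia.
pose f a := Ordinal (lt_n a).
have dE (a : 'I_r * 'I_t) : (a.1 * t + a.2) %/ t = a.1.
  by rewrite divnMDl ?(leq_ltn_trans _ (ltn_ord a.2)) // divn_small // addn0.
apply/card_gt0P; exists (f @: setT); rewrite inE; apply/induced_copyP.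
exists f; split=> // [[i j] [i' j']|a b]; last by rewrite /= !dE.
move=> E; have E1 : i = i' by apply: val_inj; rewrite /= -(dE (i, j)) -(dE (i', j')) -[_ * _ + _]/(val (f _)) E.
by move: E => /(congr1 val) /=; rewrite E1 => /addnI/val_inj->.
Qed.

(** Each label accounts for at most [t] of the [r * t] vertices of a valid set. *)
Lemma valid_count_gt0_fibers (T : finType) (L : eqType) (p : T -> L) t r :
  0 < t -> 0 < valid_count p t r setT -> r <= size (undup [seq p x | x <- enum T]).
Proof.
move=> t0 /card_gt0P[S]; rewrite inE => /andP[_ /validP[cS fS]].
set ls := undup _.
have pls x : x \in S -> p x \in ls by move=> _; rewrite mem_undup map_f // mem_enum.
rewrite -(leq_pmul2r t0) -cS -(sum_fibers (undup_uniq _) pls).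
rewrite -[_ * _]/(muln _ _) -sum1_size big_distrl /= leq_sum // => l _.
rewrite mul1n; have [->|/set0Pn[x /setIP[xS]]] := eqVneq (S :&: fiber p l) set0.
  by rewrite cards0.
by rewrite inE => /eqP <-; rewrite fS.
Qed.

Theorem theorem5p3 (r t : nat) :
  2 <= r -> 2 <= t ->
  (forall (n : nat) (e : rel 'I_n),
     r * t <= n ->
     simple_graphb e ->
     complete_multipartite e ->
     Icount (Krt r t) e = Inum (Krt r t) n ->
     exists k : nat, r <= k /\ graph_iso e (turan k n))
  /\
  (forall n : nat, r * t <= n ->
     exists k : nat, Icount (Krt r t) (turan k n) = Inum (Krt r t) n).
Proof.
move=> r2 t2.
have main n (e : rel 'I_n) : r * t <= n -> complete_multipartite e ->
    Icount (Krt r t) e = Inum (Krt r t) n ->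
    exists k : nat, r <= k /\ graph_iso e (turan k n).
  move=> rtn [p ep] emax.
  have r0 := ltnW r2; have t0 := ltnW t2.
  have cE (p' : 'I_n -> nat) := Icount_Krt p' t0 r0.
  have vmax : valid_count p t r setT = Inum (Krt r t) n.
    by rewrite -cE -emax; apply: Icount_ext => x y; rewrite ep.
  have pos : 0 < valid_count p t r setT by rewrite vmax Inum_Krt_gt0.
  have mx (p' : 'I_n -> nat) : valid_count p' t r setT <= valid_count p t r setT.
    by rewrite vmax -cE Icount_le_Inum // multipartite_simple.
  exists (size (undup [seq p x | x <- enum 'I_n])); split.
    exact: valid_count_gt0_fibers pos.
  have n0 : 0 < n by apply: leq_trans rtn; rewrite muln_gt0 r0.
  have bal x y : #|fiber p (p x)| <= #|fiber p (p y)|.+1.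
    by case: r r2 pos mx {emax vmax cE rtn r0} => [|[|s]] // _; move=> pos mx; exact: (valid_count_max_balanced t2 pos mx).
  have [f [fb fe]] := balanced_turan n0 bal.
  by exists f; split=> // x y; rewrite ep fe.
split=> [n e rtn _|n rtn]; first exact: main.
(* Symmetrization supplies a complete multipartite graph among all maximizers, to which [main]
   applies. *)
have [|e [_ mult emax]] := @multipartite_maximizer _ (Krt r t) n.
  by exists (fun x => val x.1).
by have [k [_ /Icount_iso iso]] := main n e rtn mult emax; exists k; rewrite -iso.
Qed.
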